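(* Let $\mathcal N$ be the big model of a complete first order or continuous theory, and let $\perp^I$ be a ternary relation over $\mathcal N$ that has monotonicity. Then there is a unique ternary relation $\perp^{Ic}$ over $\mathcal N$ that is countably based and agrees with $\perp^I$ on countable sets. Namely, for all small $A,B,C$, $A\perp^{Ic}_C B$ holds if and only if for all countable $A'\subseteq A$, $B'\subseteq B$, $C'\subseteq C$ there exists a countable $D$ with $C'\subseteq D\subseteq C$ such that $A'\perp^I_D B'$.
   Context: Fix an uncountable inaccessible cardinal $\upsilon$. The big model of a complete theory is its saturated model of cardinality $\upsilon$ (for a complete theory with finite models, every model is called big). A set is small if its cardinality is $<\upsilon$; countable means of cardinality at most $\aleph_0$. A ternary relation over $\mathcal N$ is a ternary relation $A\perp_C B$ on small subsets $A,B,C$ of $\mathcal N$. Monotonicity: if $A\perp_C B$, $A'\subseteq A$ and $B'\subseteq B$, then $A'\perp_C B'$. A ternary relation $\perp^I$ is countably based if for all small $A,B,C$: $A\perp^I_C B$ holds if and only if for all countable $A'\subseteq A$, $B'\subseteq B$, $C'\subseteq C$ there is a countable $D$ with $C'\subseteq D\subseteq C$ and $A'\perp^I_D B'$. Two relations agree on countable sets if they hold for the same triples $(A,B,C)$ of countable sets. *)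

(* Defs.v *)
From HB Require Import structures.
From mathcomp Require Import all_boot all_order all_algebra.
From mathcomp Require Import all_classical all_reals all_analysis.
Set Implicit Arguments.
Unset Strict Implicit.
Unset Printing Implicit Defensive.
Import Order.TTheory GRing.Theory Num.Theory.
Import numFieldNormedType.Exports.
Local Open Scope classical_set_scope.
Local Open Scope card_scope.
Local Open Scope ring_scope.

(* Cardinals are represented by types: "the cardinal U" is the cardinality of
   [set: U]. *)

Definition card_lt (T1 T2 : Type) (A : set T1) (B : set T2) : Prop :=
  A #<= B /\ ~ (B #<= A).

Notation "A '#<' B" := (card_lt A B) (at level 79) : card_scope.

Definition regular_cardinal (U : Type) : Prop :=
  forall (J : set U) (F : U -> set U),
    J #< [set: U] -> (forall j, J j -> F j #< [set: U]) ->
    \bigcup_(j in J) F j #< [set: U].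

Definition strong_limit_cardinal (U : Type) : Prop :=
  forall A : set U, A #< [set: U] -> [set B : set U | B `<=` A] #< [set: U].

Definition uncountable_inaccessible (U : Type) : Prop :=
  [/\ ~ countable [set: U], regular_cardinal U & strong_limit_cardinal U].

(* Terms and formulas are well-scoped: the index n bounds the free variables,
   so sentences are the formulas of index 0. A quantifier binds variable 0. *)

Record signature := Signature {
  func : Type;
  pred_symb : Type;
  func_arity : func -> nat;
  pred_arity : pred_symb -> nat }.

Arguments func_arity {s}.
Arguments pred_arity {s}.

Inductive term (L : signature) (n : nat) : Type :=
| Var of 'I_n
| App (f : func L) of ('I_(func_arity f) -> term L n).

Fixpoint eval_term (L : signature) (M : Type)
    (fI : forall f : func L, ('I_(func_arity f) -> M) -> M)
    (n : nat) (v : 'I_n -> M) (t : term L n) : M :=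
  match t with
  | Var i => v i
  | App f ts => fI f (fun k => eval_term fI v (ts k))
  end.

Definition env_cons (M : Type) (n : nat) (a : M) (v : 'I_n -> M)
    (i : 'I_n.+1) : M :=
  if unlift ord0 i is Some j then v j else a.

Definition env_cat (M : Type) (n m : nat) (x : 'I_n -> M) (a : 'I_m -> M)
    (i : 'I_(n + m)) : M :=
  match fintype.split i with inl j => x j | inr k => a k end.

Definition env_nil (M : Type) (i : 'I_0) : M :=
  match notF (ltn_ord i) with end.

Arguments env_nil : clear implicits.

(* An F-formula in n variables with parameters from M; F is either first order
   formulas or continuous formulas. *)
Record param_formula (F : nat -> Type) (M : Type) (n : nat) := ParamFormula {
  nparams : nat;
  body : F (n + nparams)%N;
  params : 'I_nparams -> M }.

Arguments params {F M n} p k.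

Definition over (F : nat -> Type) (M : Type) (n : nat) (A : set M) :
    set (param_formula F M n) :=
  [set p | forall k, A (params p k)].

Arguments over : clear implicits.

(* M is |M|-saturated, where hold v phi means that the tuple v satisfies phi
   (first order case), resp. the condition phi = 0 (continuous case). *)
Definition saturated (F : nat -> Type) (M : Type)
    (hold : forall n, ('I_n -> M) -> F n -> Prop) : Prop :=
  forall A : set M, A #< [set: M] ->
  forall (n : nat) (G : set (param_formula F M n)), G `<=` over F M n A ->
    let sat (x : 'I_n -> M) (p : param_formula F M n) :=
      hold _ (env_cat x (params p)) (body p) in
    (forall G0, finite_set G0 -> G0 `<=` G -> exists x, forall p, G0 p -> sat x p) ->
    exists x, forall p, G p -> sat x p.

Inductive fo_formula (L : signature) : nat -> Type :=
| FBot n : fo_formula L n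
| FEq n : term L n -> term L n -> fo_formula L n
| FPred n (P : pred_symb L) : ('I_(pred_arity P) -> term L n) -> fo_formula L n
| FImp n : fo_formula L n -> fo_formula L n -> fo_formula L n
| FAll n : fo_formula L n.+1 -> fo_formula L n.

Record fo_structure (L : signature) := FOStructure {
  fo_carrier :> Type;
  fo_inhabited : inhabited fo_carrier;
  fo_func : forall f : func L, ('I_(func_arity f) -> fo_carrier) -> fo_carrier;
  fo_pred : forall P : pred_symb L, ('I_(pred_arity P) -> fo_carrier) -> Prop }.

Arguments fo_func {L} M f x : rename.
Arguments fo_pred {L} M P x : rename.

Fixpoint fo_sat (L : signature) (M : fo_structure L) (n : nat)
    (phi : fo_formula L n) : ('I_n -> M) -> Prop :=
  match phi in fo_formula _ n return ('I_n -> M) -> Prop with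
  | FBot _ => fun v => False
  | FEq _ t u => fun v =>
      eval_term (fo_func M) v t = eval_term (fo_func M) v u
  | FPred _ P ts => fun v =>
      fo_pred M P (fun k => eval_term (fo_func M) v (ts k))
  | FImp _ psi chi => fun v => fo_sat psi v -> fo_sat chi v
  | FAll _ psi => fun v => forall a : M, fo_sat psi (env_cons a v)
  end.

Definition fo_theory (L : signature) := set (fo_formula L 0).

Definition fo_true (L : signature) (M : fo_structure L) (phi : fo_formula L 0) :=
  fo_sat phi (env_nil M).

Definition fo_model (L : signature) (T : fo_theory L) (M : fo_structure L) :=
  forall phi, T phi -> fo_true M phi.

Definition fo_complete (L : signature) (T : fo_theory L) : Prop :=
  (exists M, fo_model T M) /\
  forall phi, (forall M, fo_model T M -> fo_true M phi) \/
              (forall M, fo_model T M -> ~ fo_true M phi).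

(* The second disjunct is the saturated model of cardinality U; a theory with
   finite models has no such model, and all its models count as big. *)
Definition fo_big (U : Type) (L : signature) (T : fo_theory L)
    (M : fo_structure L) : Prop :=
  fo_model T M /\
  ((exists M0 : fo_structure L, fo_model T M0 /\ finite_set [set: M0]) \/
   ([set: M] #= [set: U] /\
    saturated (fun n (v : 'I_n -> M) phi => fo_sat phi v))).

(* Continuous logic for bounded metric structures, normalized so that all
   structures have diameter at most 1 and predicates take values in [0, 1].
   The moduli of uniform continuity are part of the signature; a modulus is a
   function from ]0, 1] to ]0, 1], its values elsewhere being irrelevant. *)

Definition is_modulus (R : realType) (D : R -> R) : Prop :=
  forall e, 0 < e <= 1 -> 0 < D e <= 1.

Record metric_signature (R : realType) := MetricSignature {
  base_signature :> signature;
  func_modulus : func base_signature -> R -> R;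
  pred_modulus : pred_symb base_signature -> R -> R;
  func_modulusP : forall f, is_modulus (func_modulus f);
  pred_modulusP : forall P, is_modulus (pred_modulus P) }.

Arguments func_modulus {R m}.
Arguments pred_modulus {R m}.

Record cl_structure (R : realType) (L : metric_signature R) := CLStructure {
  cl_carrier :> metricType R;
  cl_inhabited : inhabited cl_carrier;
  cl_diam : forall x y : cl_carrier, mdist x y <= 1;
  cl_complete_metric : forall F : set_system cl_carrier,
    ProperFilter F -> cauchy F -> exists x : cl_carrier, F --> x;
  cl_func : forall f : func L, ('I_(func_arity f) -> cl_carrier) -> cl_carrier;
  cl_pred : forall P : pred_symb L, ('I_(pred_arity P) -> cl_carrier) -> R;
  cl_pred01 : forall P x, 0 <= @cl_pred P x <= 1;
  cl_func_unif : forall f x y e, 0 < e <= 1 ->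
    (forall k, mdist (x k) (y k) < func_modulus f e) ->
    mdist (@cl_func f x) (@cl_func f y) <= e;
  cl_pred_unif : forall P x y e, 0 < e <= 1 ->
    (forall k, mdist (x k) (y k) < pred_modulus P e) ->
    `|@cl_pred P x - @cl_pred P y| <= e }.

Arguments cl_func {R L} M f x : rename.
Arguments cl_pred {R L} M P x : rename.

Definition unit_cube (R : realType) (k : nat) : set 'rV[R]_k :=
  [set x | forall i, 0 <= x ord0 i <= 1].

Arguments unit_cube : clear implicits.

(* k-ary connectives: all continuous maps from [0, 1]^k to [0, 1]; the values
   outside the cube are irrelevant. *)
Record connective (R : realType) (k : nat) := Connective {
  conn_fun :> 'rV[R]_k -> R;
  conn_continuous : {within unit_cube R k, continuous conn_fun};
  conn01 : forall x, unit_cube R k x -> 0 <= conn_fun x <= 1 }.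

Inductive cl_formula (R : realType) (L : metric_signature R) : nat -> Type :=
| CDist n : term L n -> term L n -> cl_formula L n
| CPred n (P : pred_symb L) : ('I_(pred_arity P) -> term L n) -> cl_formula L n
| CConn n k : connective R k -> ('I_k -> cl_formula L n) -> cl_formula L n
| CSup n : cl_formula L n.+1 -> cl_formula L n
| CInf n : cl_formula L n.+1 -> cl_formula L n.

Fixpoint cl_value (R : realType) (L : metric_signature R) (M : cl_structure L)
    (n : nat) (phi : cl_formula L n) : ('I_n -> M) -> R :=
  match phi in cl_formula _ n return ('I_n -> M) -> R with
  | CDist _ t u => fun v =>
      mdist (eval_term (cl_func M) v t) (eval_term (cl_func M) v u)
  | CPred _ P ts => fun v =>
      cl_pred M P (fun k => eval_term (cl_func M) v (ts k))
  | CConn _ _ u phis => fun v => u (\row_j cl_value (phis j) v)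
  | CSup _ psi => fun v => sup [set cl_value psi (env_cons a v) | a in [set: M]]
  | CInf _ psi => fun v => inf [set cl_value psi (env_cons a v) | a in [set: M]]
  end.

(* A theory is a set of closed conditions phi = 0, given by the sentences phi. *)
Definition cl_theory (R : realType) (L : metric_signature R) :=
  set (cl_formula L 0).

Definition cl_Th (R : realType) (L : metric_signature R) (M : cl_structure L) :
    cl_theory L :=
  [set phi | cl_value phi (env_nil M) = 0].

Definition cl_model (R : realType) (L : metric_signature R) (T : cl_theory L)
    (M : cl_structure L) : Prop :=
  T `<=` cl_Th M.

Definition cl_complete (R : realType) (L : metric_signature R)
    (T : cl_theory L) : Prop :=
  exists M : cl_structure L, T = cl_Th M.

Definition cl_big (U : Type) (R : realType) (L : metric_signature R)
    (T : cl_theory L) (M : cl_structure L) : Prop :=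
  cl_model T M /\
  ((exists M0 : cl_structure L, cl_model T M0 /\ finite_set [set: M0]) \/
   ([set: M] #= [set: U] /\
    saturated (fun n (v : 'I_n -> M) phi => cl_value phi v = 0))).

Inductive big_model (R : realType) (U : Type) : Type :=
| FirstOrderBig (L : signature) (T : fo_theory L) (M : fo_structure L)
    of fo_complete T & fo_big U T M
| ContinuousBig (L : metric_signature R) (T : cl_theory L) (M : cl_structure L)
    of cl_complete T & cl_big U T M.

Definition big_carrier (R : realType) (U : Type) (N : big_model R U) : Type :=
  match N with
  | FirstOrderBig _ _ M _ _ => M
  | ContinuousBig _ _ M _ _ => M
  end.

Coercion big_carrier : big_model >-> Sortclass.

Record small_set (U N : Type) := SmallSet {
  small_carrier :> set N;
  small_setP : small_carrier #< [set: U] }.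

Definition ternary_relation (U N : Type) :=
  small_set U N -> small_set U N -> small_set U N -> Prop.

(* In the following, I A C B stands for "A is independent from B over C". *)

Definition monotonicity (U N : Type) (I : ternary_relation U N) : Prop :=
  forall A B C A' B' : small_set U N,
    I A C B -> A' `<=` A -> B' `<=` B -> I A' C B'.

Definition countable_approx (U N : Type) (I : ternary_relation U N) :
    ternary_relation U N :=
  fun A C B => forall A' B' C' : small_set U N,
    countable A' -> countable B' -> countable C' ->
    A' `<=` A -> B' `<=` B -> C' `<=` C ->
    exists D : small_set U N,
      [/\ countable D, C' `<=` D, D `<=` C & I A' D B'].

Definition countably_based (U N : Type) (I : ternary_relation U N) : Prop :=
  forall A B C : small_set U N, I A C B <-> countable_approx I A C B.

Definition agree_on_countable (U N : Type) (I J : ternary_relation U N) : Prop :=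
  forall A B C : small_set U N,
    countable A -> countable B -> countable C -> (I A C B <-> J A C B).

(* Main.v *)
Require Import Defs.
From HB Require Import structures.
From mathcomp Require Import all_boot all_order all_algebra.
From mathcomp Require Import all_classical all_reals all_analysis.
Set Implicit Arguments.
Unset Strict Implicit.
Unset Printing Implicit Defensive.
Local Open Scope classical_set_scope.

(** The relation [countable_approx I] consults [I] only at triples of countable
sets, so relations that agree on countable sets have the same approximation
([eq_countable_approx]). For monotone [I] the approximation agrees with [I]
on countable sets ([countable_approx_agree]); hence approximating twice is the
same as approximating once, which is to say that [countable_approx I] is
countably based. A countably based relation is its own approximation, so one
that agrees with [I] on countable sets can only be [countable_approx I]. *)

Lemma small_set_inj (U N : Type) (A B : small_set U N) :
  A `<=` B -> B `<=` A -> A = B.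
Proof.
case: A B => [A sA] [B sB] /= AB BA.
have eAB : A = B by apply/seteqP.
by subst B; congr SmallSet; exact: Prop_irrelevance.
Qed.

Lemma eq_ternary_relation (U N : Type) (I J : ternary_relation U N) :
  (forall A B C, I A C B <-> J A C B) -> I = J.
Proof.
by move=> IJ; apply/funext => A; apply/funext => C; apply/funext => B; apply/propext.
Qed.

Lemma eq_countable_approx (U N : Type) (I J : ternary_relation U N) :
  agree_on_countable I J -> countable_approx I = countable_approx J.
Proof.
move=> IJ; apply: eq_ternary_relation => A B C.
split=> AB A' B' C' cA cB cC sA sB sC;
  have [D [cD CD DC ID]] := AB A' B' C' cA cB cC sA sB sC;
  by exists D; split=> //; apply/(IJ A' B' D).
Qed.

(** Over a countable base [C] both inclusions can be met by [C] itself, and only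
by [C] once [C' = C]. Monotonicity carries [I] from [A] and [B] to their
countable subsets. *)
Lemma countable_approx_agree (U N : Type) (I : ternary_relation U N) :
  monotonicity I -> agree_on_countable (countable_approx I) I.
Proof.
move=> monoI A B C cA cB cC; split=> [AB|IAB A' B' C' _ _ _ sA sB sC].
  have [D [_ CD DC ID]] := AB A B C cA cB cC (fun=> id) (fun=> id) (fun=> id).
  by rewrite (small_set_inj CD DC).
by exists C; split=> //; exact: monoI IAB sA sB.
Qed.

Theorem lemma3p1p4 (R : realType) (U : Type) (HU : uncountable_inaccessible U)
    (N : big_model R U) (I : ternary_relation U N) (HI : monotonicity I) :
  exists Ic : ternary_relation U N,
    unique (fun J : ternary_relation U N =>
              countably_based J /\ agree_on_countable J I) Ic /\
    forall A B C : small_set U N,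
      Ic A C B <->
      (forall A' B' C' : small_set U N,
         countable A' -> countable B' -> countable C' ->
         A' `<=` A -> B' `<=` B -> C' `<=` C ->
         exists D : small_set U N,
           [/\ countable D, C' `<=` D, D `<=` C & I A' D B']).
Proof.
have agreeI := countable_approx_agree HI.
exists (countable_approx I); split; last by [].
split=> [|J [basedJ agreeJ]].
  by split=> // A B C; rewrite (eq_countable_approx agreeI).
by rewrite -(eq_countable_approx agreeJ); apply/esym/eq_ternary_relation.
Qed.
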